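(* Let $\mathcal{P}$ be an ADP problem. Then $\mathcal{P}$ is iAST if and only if the ADP problem $\mathcal{U}(\mathcal{P})\cup\{\ell\to\mu^{\mathsf{false}}\mid \ell\to\mu^m\in\mathcal{P}\setminus\mathcal{U}(\mathcal{P})\}$ is iAST (i.e., the probabilistic usable rules processor, which sets the flag of all non-usable ADPs to $\mathsf{false}$, is sound and complete).
   Context: Fix a finite signature $\Sigma=\mathcal{D}\uplus\mathcal{C}$ (defined symbols and constructors) and a set of variables $\mathcal{V}$; all left-hand sides of ADPs have root in $\mathcal{D}$. For each $f\in\mathcal{D}$ let $f^\#$ be a fresh symbol of the same arity, $\mathcal{D}^\#=\{f^\#\mid f\in\mathcal{D}\}$, $\Sigma^\#=\Sigma\uplus\mathcal{D}^\#$; elements of $\mathcal{T}(\Sigma^\#,\mathcal{V})$ are annotated terms. $\mathrm{pos}_{\Sigma'}(t)$ is the set of positions of $t$ carrying a symbol of $\Sigma'$. $\flat(t)$ removes all annotations from $t$; $t^\#$ is $t$ with its (defined) root symbol annotated and no other annotations; $\flat_{\uparrow\pi}(t)$ removes all annotations strictly above position $\pi$. $t\trianglelefteq_\# s$ means $t=\flat(s|_\pi)$ for some $\pi\in\mathrm{pos}_{\mathcal{D}^\#}(s)$. A finite multi-distribution on $A\neq\emptyset$ is a finite multiset $\mu$ of pairs $(p:a)$, $0<p\le1$, $a\in A$, with probabilities summing to 1; $\mathrm{Supp}(\mu)$ is the multiset of its elements. An ADP is $\ell\to\{p_1:r_1,\dots,p_k:r_k\}^m$ with $\ell\in\mathcal{T}(\Sigma,\mathcal{V})\setminus\mathcal{V}$,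 $m\in\{\mathsf{true},\mathsf{false}\}$, $\{p_1:r_1,\dots,p_k:r_k\}$ a finite multi-distribution on $\mathcal{T}(\Sigma^\#,\mathcal{V})$, $\mathcal{V}(r_j)\subseteq\mathcal{V}(\ell)$. An ADP problem is a finite set $\mathcal{P}$ of ADPs. An annotated term $t$ is a $\mathcal{P}$-normal form if no subterm of $\flat(t)$ is an instance of a left-hand side of $\mathcal{P}$; $\mathtt{ANF}_{\mathcal{P}}$ is the set of annotated terms whose proper subterms are all $\mathcal{P}$-normal forms. $s\hookrightarrow_{\mathcal{P}}\{p_1:t_1,\dots,p_k:t_k\}$ holds if there are an ADP $\ell\to\{p_1:r_1,\dots,p_k:r_k\}^m\in\mathcal{P}$, a substitution $\sigma$ and $\pi\in\mathrm{pos}_{\mathcal{D}\cup\mathcal{D}^\#}(s)$ with $\flat(s|_\pi)=\ell\sigma\in\mathtt{ANF}_{\mathcal{P}}$ such that for all $j$: (pr) $t_j=s[r_j\sigma]_\pi$ if $\pi\in\mathrm{pos}_{\mathcal{D}^\#}(s)$, $m=\mathsf{true}$; (p) $t_j=\flat_{\uparrow\pi}(s[r_j\sigma]_\pi)$ if $\pi\in\mathrm{pos}_{\mathcal{D}^\#}(s)$, $m=\mathsf{false}$; (r) $t_j=s[\flat(r_j)\sigma]_\pi$ if $\pi\notin\mathrm{pos}_{\mathcal{D}^\#}(s)$, $m=\mathsf{true}$; (irr) $t_j=\flat_{\uparrow\pi}(s[\flat(r_j)\sigma]_\pi)$ if $\pi\notin\mathrm{pos}_{\mathcal{D}^\#}(s)$,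 $m=\mathsf{false}$. A $\mathcal{P}$-chain tree (CT) is $\mathfrak{T}=(V,E,L,V_P)$: (1) $(V,E)$ a (possibly infinite) directed tree, $V\neq\emptyset$, every node with finitely many children; (2) $L$ labels each node $v$ with $(p_v,t_v)\in(0,1]\times\mathcal{T}(\Sigma^\#,\mathcal{V})$, $p_v=1$ at the root; (3) $V_P$ is a set of inner nodes, $V_R$ the remaining inner nodes; (4) if $v\in V_P$ has children $w_1,\dots,w_k$ then $t_v\hookrightarrow_{\mathcal{P}}\{\frac{p_{w_1}}{p_v}:t_{w_1},\dots,\frac{p_{w_k}}{p_v}:t_{w_k}\}$ by case (pr) or (p); (5) likewise for $v\in V_R$ by case (r) or (irr); (6) every infinite path contains infinitely many nodes of $V_P$. $|\mathfrak{T}|_{\mathtt{Leaf}}$ is the sum of $p_v$ over all leaves. $\mathcal{P}$ is iAST if $|\mathfrak{T}|_{\mathtt{Leaf}}=1$ for every $\mathcal{P}$-CT. Usable rules: for $f\in\Sigma^\#$ let $\mathrm{Rules}_{\mathcal{P}}(f)=\{\ell\to\mu^{\mathsf{true}}\in\mathcal{P}\mid\mathrm{root}(\ell)=f\}$. For $t\in\mathcal{T}(\Sigma^\#,\mathcal{V})$, $\mathcal{U}_{\mathcal{P}}(t)$ is the smallest set with $\mathcal{U}_{\mathcal{P}}(x)=\emptyset$ for $x\in\mathcal{V}$ and $\mathcal{U}_{\mathcal{P}}(f(t_1,\dots,t_n))=\mathrm{Rules}_{\mathcal{P}}(f)\cup\bigcup_{i=1}^n\mathcal{U}_{\mathcal{P}}(t_i)\cup\bigcup_{\ell\to\mu^{\mathsf{true}}\in\mathrm{Rules}_{\mathcal{P}}(f),\,r\in\mathrm{Supp}(\mu)}\mathcal{U}_{\mathcal{P}}(\flat(r))$.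 The usable rules of $\mathcal{P}$ are $\mathcal{U}(\mathcal{P})=\bigcup_{\ell\to\mu^m\in\mathcal{P},\,r\in\mathrm{Supp}(\mu),\,t\trianglelefteq_\# r}\mathcal{U}_{\mathcal{P}}(t^\#)$. *)

(* Defs.v *)
From HB Require Import structures.
From mathcomp Require Import all_boot all_order all_algebra.
From mathcomp Require Import finmap multiset.
From mathcomp Require Import all_classical all_reals ereal esum.

Set Implicit Arguments.
Unset Strict Implicit.
Unset Printing Implicit Defensive.

Import Order.TTheory GRing.Theory Num.Theory.

Local Open Scope mset_scope.
Local Open Scope classical_set_scope.
Local Open Scope ring_scope.

Record signature := Signature { sym :> finType; arity : sym -> nat }.

Definition sigU (S T : signature) : signature :=
  @Signature (sym S + sym T)%type
    (fun f => match f with inl g => arity g | inr g => arity g end).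

(* Sigma^# for Sigma = D (+) C: the summand [inr d] is the annotated d^#,
   [inl (inl d)] the plain defined symbol d, [inl (inr c)] a constructor. *)
Definition sharp (D C : signature) : signature := sigU (sigU D C) D.

Inductive term (S : signature) (V : Type) : Type :=
| Var of V
| App (f : S) of ('I_(arity f) -> term S V).

Arguments Var {S V} x.
Arguments App {S V} f args.

HB.instance Definition _ (S : signature) (V : Type) := gen_eqMixin (term S V).
HB.instance Definition _ (S : signature) (V : Type) :=
  gen_choiceMixin (term S V).

(* T(Sigma, V) and T(Sigma^#, V) *)
Notation uterm D C V := (term (sigU D C) V).
Notation aterm D C V := (term (sharp D C) V).

Definition root {S : signature} {V : Type} (t : term S V) : option S :=
  match t with Var _ => None | App f _ => Some f end.

Fixpoint vars {S : signature} {V : Type} (t : term S V) : set V :=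
  match t with
  | Var x => [set x]
  | App f args => \bigcup_i vars (args i)
  end.

Fixpoint subst {S : signature} {V : Type} (s : V -> term S V) (t : term S V)
    : term S V :=
  match t with
  | Var x => s x
  | App f args => App f (fun i => subst s (args i))
  end.

(* Positions are lists of argument indices counted from 0. *)
Fixpoint subterm_at {S : signature} {V : Type} (t : term S V) (p : seq nat)
    : option (term S V) :=
  match p, t with
  | [::], _ => Some t
  | i :: q, App f args =>
      if insub i is Some j then subterm_at (args j) q else None
  | _ :: _, Var _ => None
  end.

Fixpoint replace_at {S : signature} {V : Type} (t : term S V) (p : seq nat)
    (u : term S V) : term S V :=
  match p, t with
  | [::], _ => u
  | i :: q, App f args =>
      App f (fun j => if val j == i then replace_at (args j) q u else args j)
  | _ :: _, Var _ => t
  end.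

Definition pos {S : signature} {V : Type} (F : set S) (t : term S V)
    : set (seq nat) :=
  [set p | exists f args, F f /\ subterm_at t p = Some (App f args)].

Definition Dsym (D C : signature) : set (sharp D C) :=
  [set f | exists d : D, f = inl (inl d)].

Definition Dsharp (D C : signature) : set (sharp D C) :=
  [set f | exists d : D, f = inr d].

(* inclusion of T(Sigma, V) into T(Sigma^#, V) *)
Fixpoint emb {D C : signature} {V : Type} (t : uterm D C V) : aterm D C V :=
  match t with
  | Var x => Var x
  | App f args => @App (sharp D C) V (inl f) (fun i => emb (args i))
  end.

Fixpoint flat {D C : signature} {V : Type} (t : aterm D C V) : uterm D C V :=
  match t with
  | Var x => Var x
  | App f args =>
      match f return ('I_(@arity (sharp D C) f) -> uterm D C V) -> uterm D C V with
      | inl g => @App (sigU D C) V g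
      | inr d => @App (sigU D C) V (inl d)
      end (fun i => flat (args i))
  end.

Definition flat_root {D C : signature} {V : Type} (t : aterm D C V)
    : aterm D C V :=
  match t with
  | Var x => Var x
  | App f args =>
      match f return ('I_(@arity (sharp D C) f) -> aterm D C V) -> aterm D C V with
      | inl g => @App (sharp D C) V (inl g)
      | inr d => @App (sharp D C) V (inl (inl d))
      end args
  end.

Fixpoint flat_above {D C : signature} {V : Type} (p : seq nat)
    (t : aterm D C V) : aterm D C V :=
  match p, t with
  | i :: q, App f args =>
      flat_root
        (App f (fun j => if val j == i then flat_above q (args j) else args j))
  | _, _ => t
  end.

(* t^#; only meaningful when the root of t is a defined symbol *)
Definition annot {D C : signature} {V : Type} (t : uterm D C V) : aterm D C V :=
  match t with
  | Var x => Var x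
  | App f args =>
      match f return ('I_(@arity (sigU D C) f) -> aterm D C V) -> aterm D C V with
      | inl d => @App (sharp D C) V (inr d)
      | inr c => @App (sharp D C) V (inl (inr c))
      end (fun i => emb (args i))
  end.

Definition sub_sharp {D C : signature} {V : Type}
    (t : uterm D C V) (s : aterm D C V) : Prop :=
  exists2 p, pos (@Dsharp D C) s p & omap flat (subterm_at s p) = Some t.

Definition multidist {R : realType} {A : choiceType} (mu : {mset (R * A)}) : Prop :=
  (forall x, x \in mu -> 0 < x.1 <= 1) /\ \sum_(x <- mu) x.1 = 1.

Definition supp {R : realType} {A : choiceType} (mu : {mset (R * A)}) : set A :=
  [set a | exists p, (p, a) \in mu].

Record adp (R : realType) (D C : signature) (V : Type) := Adp {
  lhs : uterm D C V;
  rhs : {mset (R * aterm D C V)};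
  flag : bool
}.

Definition is_adp {R : realType} {D C : signature} {V : Type}
    (a : adp R D C V) : Prop :=
  [/\ exists d : D, root (lhs a) = Some (inl d),
      multidist (rhs a) &
      forall r, supp (rhs a) r -> vars r `<=` vars (lhs a)].

Definition adp_problem {R : realType} {D C : signature} {V : Type}
    (P : set (adp R D C V)) : Prop :=
  finite_set P /\ forall a, P a -> is_adp a.

Definition normal_form {R : realType} {D C : signature} {V : Type}
    (P : set (adp R D C V)) (t : aterm D C V) : Prop :=
  ~ exists p a s, P a /\ subterm_at (flat t) p = Some (subst s (lhs a)).

Definition ANF {R : realType} {D C : signature} {V : Type}
    (P : set (adp R D C V)) : set (aterm D C V) :=
  [set t | forall p u, p <> [::] -> subterm_at t p = Some u ->
           normal_form P u].

Inductive rewrite_case := case_pr | case_p | case_r | case_irr.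

Definition case_applies {D C : signature} {V : Type} (c : rewrite_case)
    (s : aterm D C V) (p : seq nat) (m : bool) : Prop :=
  match c with
  | case_pr  => pos (@Dsharp D C) s p /\ m = true
  | case_p   => pos (@Dsharp D C) s p /\ m = false
  | case_r   => ~ pos (@Dsharp D C) s p /\ m = true
  | case_irr => ~ pos (@Dsharp D C) s p /\ m = false
  end.

Definition case_result {D C : signature} {V : Type} (c : rewrite_case)
    (s : aterm D C V) (p : seq nat) (sg : V -> uterm D C V) (r : aterm D C V)
    : aterm D C V :=
  match c with
  | case_pr  => replace_at s p (subst (emb \o sg) r)
  | case_p   => flat_above p (replace_at s p (subst (emb \o sg) r))
  | case_r   => replace_at s p (emb (subst sg (flat r)))
  | case_irr => flat_above p (replace_at s p (emb (subst sg (flat r))))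
  end.

(* Substitutions map to T(Sigma, V): as flat (s|_p) = l sg is free of
   annotations and V(r) is included in V(l), nothing else can occur. *)
Definition rewrites {R : realType} {D C : signature} {V : Type}
    (P : set (adp R D C V)) (c : rewrite_case)
    (s : aterm D C V) (mu : {mset (R * aterm D C V)}) : Prop :=
  exists (a : adp R D C V) (sg : V -> uterm D C V) (p : seq nat),
    [/\ P a,
        pos (@Dsym D C `|` @Dsharp D C) s p,
        omap flat (subterm_at s p) = Some (subst sg (lhs a)) /\
          ANF P (emb (subst sg (lhs a))),
        case_applies c s p (flag a) &
        mu = seq_mset [seq (x.1, case_result c s p sg x.2) | x <- rhs a]].

(* [ct_prob] and [ct_term] are the two components of the labelling L; their
   values outside [ct_node] are irrelevant. *)
Record tree (R : realType) (D C : signature) (V : Type) (N : choiceType) :=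
  Tree {
    ct_node : set N;
    ct_edge : rel N;
    ct_prob : N -> R;
    ct_term : N -> aterm D C V;
    ct_P : set N
  }.

Definition ct_children {R : realType} {D C : signature} {V : Type}
    {N : choiceType} (T : tree R D C V N) (v : N) : set N :=
  [set w | ct_edge T v w].

Definition ct_inner {R : realType} {D C : signature} {V : Type}
    {N : choiceType} (T : tree R D C V N) : set N :=
  [set v | ct_node T v /\ ct_children T v !=set0].

Definition ct_leaf {R : realType} {D C : signature} {V : Type}
    {N : choiceType} (T : tree R D C V N) : set N :=
  ct_node T `\` ct_inner T.

Definition ct_R {R : realType} {D C : signature} {V : Type}
    {N : choiceType} (T : tree R D C V N) : set N :=
  ct_inner T `\` ct_P T.

(* (V, E) is a directed tree with root r: exactly one path leads from r to
   each node. *)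
Definition directed_tree {N : choiceType} (V : set N) (E : rel N) (r : N)
    : Prop :=
  [/\ V r,
      forall u v, E u v -> V u /\ V v &
      forall v, V v -> exists! q : seq N, path E r q /\ last r q = v].

Definition ct_step {R : realType} {D C : signature} {V : Type}
    {N : choiceType} (T : tree R D C V N) (v : N) : {mset (R * aterm D C V)} :=
  seq_mset [seq (ct_prob T w / ct_prob T v, ct_term T w)
           | w <- fset_set (ct_children T v)].

Record chain_tree {R : realType} {D C : signature} {V : Type}
    {N : choiceType} (P : set (adp R D C V)) (T : tree R D C V N) : Prop :=
  ChainTree {
    ct_tree : exists2 r,
      directed_tree (ct_node T) (ct_edge T) r & ct_prob T r = 1;
    ct_finite : forall v, ct_node T v -> finite_set (ct_children T v);
    ct_prob01 : forall v, ct_node T v -> 0 < ct_prob T v <= 1;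
    ct_P_inner : ct_P T `<=` ct_inner T;
    ct_P_step : forall v, ct_P T v ->
      rewrites P case_pr (ct_term T v) (ct_step T v) \/
      rewrites P case_p (ct_term T v) (ct_step T v);
    ct_R_step : forall v, ct_R T v ->
      rewrites P case_r (ct_term T v) (ct_step T v) \/
      rewrites P case_irr (ct_term T v) (ct_step T v);
    ct_inf : forall x : nat -> N, (forall n, ct_edge T (x n) (x n.+1)) ->
      infinite_set (range x `&` ct_P T)
  }.

Definition leaf_weight {R : realType} {D C : signature} {V : Type}
    {N : choiceType} (T : tree R D C V N) : \bar R :=
  (\esum_(v in ct_leaf T) (ct_prob T v)%:E)%E.

Definition iAST {R : realType} {D C : signature} {V : Type}
    (P : set (adp R D C V)) : Prop :=
  forall (N : choiceType) (T : tree R D C V N),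
    chain_tree P T -> leaf_weight T = 1%:E.

Definition Rules {R : realType} {D C : signature} {V : Type}
    (P : set (adp R D C V)) (f : sharp D C) : set (adp R D C V) :=
  [set a | [/\ P a, flag a = true & root (emb (lhs a)) = Some f]].

(* [usable_term P t] is U_P(t): the inductive definition is the least solution
   of the defining equations. *)
Inductive usable_term {R : realType} {D C : signature} {V : Type}
    (P : set (adp R D C V)) : aterm D C V -> set (adp R D C V) :=
| usable_root f args a :
    Rules P f a -> usable_term P (App f args) a
| usable_arg f args i a :
    usable_term P (args i) a -> usable_term P (App f args) a
| usable_rhs f args b r a :
    Rules P f b -> supp (rhs b) r -> usable_term P (emb (flat r)) a ->
    usable_term P (App f args) a.

Definition usable_rules {R : realType} {D C : signature} {V : Type}
    (P : set (adp R D C V)) : set (adp R D C V) :=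
  [set a | exists b r t, [/\ P b, supp (rhs b) r, sub_sharp t r &
                             usable_term P (annot t) a]].

Definition usable_rules_proc {R : realType} {D C : signature} {V : Type}
    (P : set (adp R D C V)) : set (adp R D C V) :=
  usable_rules P `|`
  [set Adp (lhs a) (rhs a) false | a in P `\` usable_rules P].

Lemma usable_term_sub {R : realType} {D C : signature} {V : Type}
    (P : set (adp R D C V)) t : usable_term P t `<=` P.
Proof. by move=> a; elim=> // f args {}a []. Qed.

Lemma usable_rules_proc_problem {R : realType} {D C : signature} {V : Type}
    (P : set (adp R D C V)) : adp_problem P -> adp_problem (usable_rules_proc P).
Proof.
have UP : usable_rules P `<=` P by move=> a [b [r [t [_ _ _ /usable_term_sub]]]].
move=> [finP adpP]; split.
  rewrite finite_setU; split; first exact: sub_finite_set finP.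
  by apply: finite_image; apply: sub_finite_set finP => a [].
by move=> a [/UP/adpP //|[b [/adpP [h1 h2 h3] _] <-]]; split.
Qed.

(* Main.v *)
(* Both problems have the same left-hand sides, hence the same normal forms and
   the same redexes; only flags differ, and a cleared flag only removes
   annotations. So a chain tree of the processed problem is replayed in P by
   keeping more annotations, which gives completeness.

   For soundness, call a term guarded if below each of its annotations every
   symbol outside normal forms has only usable rules. Innermost steps of P
   preserve guardedness, since new annotations come from right-hand sides
   instantiated with normal forms, and on guarded terms the two problems perform
   the same steps. An arbitrary chain tree of P from t is handled by induction on
   the finitely many initial annotations that are ignored: starting with all of
   them dropped, the tree is replayed in the processed problem until a dropped
   annotation is rewritten. The cut tree has leaf weight 1. At a cut node the
   arguments of the redex are normal forms, so the annotation can be restored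
   without losing guardedness, and the induction hypothesis applies to the
   subtree. *)

From mathcomp Require Import all_boot all_order all_algebra.
From mathcomp Require Import finmap multiset.
From mathcomp Require Import all_classical all_reals ereal esum.
Require Import Defs.

Set Implicit Arguments.
Unset Strict Implicit.
Unset Printing Implicit Defensive.

Import Order.TTheory GRing.Theory Num.Theory.

Local Open Scope classical_set_scope.
Local Open Scope ring_scope.

(** * Positions, replacement and substitution in terms *)

Section Terms.
Variables (S : signature) (V : Type).
Implicit Types (t u : term S V) (p q : seq nat).

Definition root_at t p : option S := obind root (subterm_at t p).

Lemma subterm_at0 t : subterm_at t [::] = Some t.
Proof. by case: t. Qed.

Lemma subterm_at_cat t p q :
  subterm_at t (p ++ q) = obind (fun u => subterm_at u q) (subterm_at t p).
Proof.
elim: p t => [|i p IH] [x|f args] //=.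
by case: insub.
Qed.

Lemma posE (F : set S) t p :
  pos F t p <-> exists2 f, F f & root_at t p = Some f.
Proof.
rewrite /pos /root_at /=; split=> [[f [args [Ff ->]]]|[f Ff]]; first by exists f.
case: subterm_at => //= -[x|g args] //= [gf].
by exists g, args; split=> //; rewrite gf.
Qed.

Lemma subterm_at_replace_cat t p q u : subterm_at t p ->
  subterm_at (replace_at t p u) (p ++ q) = subterm_at u q.
Proof.
elim: p t => [|i p IH] [x|f args] //=.
case: insubP => //= j _ ji; rewrite ji eqxx; exact: IH.
Qed.

(** Positions strictly above [p] are included: the subterm there changes, its root symbol does
    not. *)
Lemma root_at_replace t p p' u : ~~ prefix p p' ->
  root_at (replace_at t p u) p' = root_at t p'.
Proof.
rewrite /root_at.
elim: p t p' => [|i p IH] [x|f args] [|i' p'] //=.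
case: insubP => //= j _ ji.
by case: (eqVneq i i') => [ii'|ne] /=;
  rewrite ji; [rewrite ii' eqxx => /IH | rewrite eq_sym (negbTE ne)].
Qed.

Lemma subterm_at_replace_par t p p' u : ~~ prefix p p' -> ~~ prefix p' p ->
  subterm_at (replace_at t p u) p' = subterm_at t p'.
Proof.
elim: p t p' => [|i p IH] [x|f args] [|i' p'] //=.
case: insubP => //= j _ ji.
by case: (eqVneq i i') => [ii'|ne] /=;
  rewrite ji; [rewrite ii' eqxx; exact: IH | rewrite eq_sym (negbTE ne)].
Qed.

Lemma subterm_at_subst (s : V -> term S V) t q u :
  subterm_at t q = Some u -> subterm_at (subst s t) q = Some (subst s u).
Proof.
elim: q t => [|i q IH] [x|f args] //=.
- by case=> <-; rewrite subterm_at0.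
- by case=> <-.
by case: insubP => // j _ _; exact: IH.
Qed.

(** For the substitution of a redex the images [s x] are normal forms, so the second alternative
    makes the subterm at [q] a normal form. *)
Lemma root_at_subst (s : V -> term S V) t q f :
  root_at (subst s t) q = Some f ->
  root_at t q = Some f \/
  exists x q' u, [/\ vars t x, subterm_at (s x) q' = Some u &
                    subterm_at (subst s t) q = Some u].
Proof.
rewrite /root_at; elim: q t => [|i q IH] [x|g args] /=.
- by move=> h; right; exists x, [::], (s x); rewrite !subterm_at0.
- by move=> ->; left.
- case e: (subterm_at _ _) => [u|] //= _.
  by right; exists x, (i :: q), u; split.
case: insub => //= j /IH [->|[x [q' [u [xt h1 h2]]]]]; first by left.
by right; exists x, q', u; split=> //; exists j.
Qed.

Lemma vars_subterm_at t x : vars t x -> exists q, subterm_at t q = Some (Var x).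
Proof.
elim: t => [y|f args IH] /=; first by move=> ->; exists [::].
move=> [j _ /IH [q hq]]; exists (val j :: q) => /=.
by rewrite valK.
Qed.

Lemma finite_positions t :
  exists l : seq (seq nat), forall p, subterm_at t p -> p \in l.
Proof.
elim: t => [x|f args IH].
  by exists [:: [::]] => -[|i p].
have [l hl] := choice IH.
exists ([::] :: flatten [seq [seq val i :: q | q <- l i] | i <- enum 'I_(arity f)]).
move=> [|i p] //=; rewrite inE /=.
case: insubP => //= j _ ji /hl pl.
by apply/flatten_mapP; exists j; rewrite ?mem_enum // -ji map_f.
Qed.

End Terms.

(** * Annotations and their positions *)

Section Annotations.
Variables (D C : signature) (V : Type).
Implicit Types (t s : aterm D C V) (u : uterm D C V) (p q : seq nat).

Definition unsharp (f : sharp D C) : sigU D C :=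
  match f with inl g => g | inr d => inl d end.

Lemma flat_emb u : flat (emb u) = u.
Proof. by elim: u => //= f args IH; congr App; apply/funext. Qed.

Lemma subterm_at_flat t p : subterm_at (flat t) p = omap flat (subterm_at t p).
Proof.
by elim: p t => [|i p IH] [x|[g|d] args] //=; case: insub => [j|] //=; rewrite IH.
Qed.

Lemma subterm_at_emb u p : subterm_at (emb u) p = omap emb (subterm_at u p).
Proof.
by elim: p u => [|i p IH] [x|g args] //=; case: insub => [j|] //=; rewrite IH.
Qed.

Lemma root_flat t : root (flat t) = omap unsharp (root t).
Proof. by case: t => [x|[g|d] args]. Qed.

Lemma root_at_flat t p : root_at (flat t) p = omap unsharp (root_at t p).
Proof.
by rewrite /root_at subterm_at_flat; case: subterm_at => //= a; exact: root_flat.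
Qed.

Lemma vars_flat t : vars (flat t) = vars t.
Proof.
by elim: t => [x|[g|d] args IH] //=; apply: eq_bigcupr => i _; rewrite IH.
Qed.

Definition annotated t p := exists d, root_at t p = Some (inr d).

Lemma pos_DsharpE t p : pos (@Dsharp D C) t p <-> annotated t p.
Proof.
rewrite posE; split=> [[f [d ->] h]|[d h]]; first by exists d.
by exists (inr d) => //; exists d.
Qed.

Lemma pos_DE t p : pos (@Dsym D C `|` @Dsharp D C) t p <->
  exists d, root_at (flat t) p = Some (inl d).
Proof.
rewrite posE root_at_flat; split=> [[f [[d ->]|[d ->]] ->]|]; try by exists d.
case: root_at => [[[e|c]|e]|] [d] //=.
- by exists (inl (inl e)) => //; left; exists e.
- by exists (inr e) => //; right; exists e.
Qed.

Lemma annotated_emb u p : ~ annotated (emb u) p.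
Proof.
by move=> [d]; rewrite /root_at subterm_at_emb; case: subterm_at => //= -[].
Qed.

Lemma annotated_subst (sg : V -> uterm D C V) t p :
  annotated (subst (emb \o sg) t) p <-> annotated t p.
Proof.
rewrite /annotated /root_at.
elim: p t => [|i p IH] [x|f args] //=; last by case: insub.
  by split=> [[d]|[]//]; case: (sg x).
rewrite subterm_at_emb; split=> [[d]|[]//].
by case: subterm_at => //= -[].
Qed.

Lemma flat_replace t p s : flat (replace_at t p s) = replace_at (flat t) p (flat s).
Proof.
by elim: p t => [|i p IH] [x|[g|d] args] //=; congr App; apply/funext => j;
  case: eqP.
Qed.

Lemma flat_flat_above p t : flat (flat_above p t) = flat t.
Proof.
by elim: p t => [|i p IH] [x|[g|d] args] //=; congr App; apply/funext => j;
  case: eqP.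
Qed.

Lemma flat_subst (sg : V -> uterm D C V) t :
  flat (subst (emb \o sg) t) = subst sg (flat t).
Proof.
by elim: t => [x|[g|d] args IH] /=; rewrite ?flat_emb //; congr App; apply/funext.
Qed.

Lemma annotated_flat_above q t p :
  annotated (flat_above q t) p <-> annotated t p /\ (prefix p q -> p = q).
Proof.
rewrite /annotated /root_at.
elim: q t p => [|i q IH] t p.
  by split=> [|[]//] h; split=> //; case: p h.
case: t => [x|f args]; first by case: p => [|? ?]; split=> [[]|[[]]].
case: p => [|j p].
  by case: f args => [g|d] args /=; split=> [[]//|[_ /(_ isT)]].
have -> : subterm_at (flat_above (i :: q) (App f args)) (j :: p) =
   if insub j is Some k then
     subterm_at (if val k == i then flat_above q (args k) else args k) p
   else None by case: f args.
rewrite /=; case: insubP => [k _ kj|_] /=; last by split=> [[]|[[]]].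
rewrite kj; case: (eqVneq j i) => [->|ne] /=.
  rewrite IH; split=> -[h1 h2]; split=> // /h2; first by move=> ->.
  by case.
by split=> [|[]//].
Qed.

(* Annotates the defined symbols of [u] at the positions in [X]; a term is
   recovered from its underlying plain term and its annotated positions. *)
Fixpoint annotate (X : set (seq nat)) u : aterm D C V :=
  match u with
  | Var x => Var x
  | App f args =>
      match f return ('I_(@arity (sigU D C) f) -> aterm D C V) -> aterm D C V with
      | inl d => if `[< X [::] >] then @App (sharp D C) V (inr d)
                 else @App (sharp D C) V (inl (inl d))
      | inr c => @App (sharp D C) V (inl (inr c))
      end (fun i => annotate [set p | X (val i :: p)] (args i))
  end.

Lemma flat_annotate X u : flat (annotate X u) = u.
Proof.
elim: u X => [x|[d|c] args IH] X //=; last by congr App; apply/funext.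
by case: ifP => _ /=; congr App; apply/funext.
Qed.

Lemma annotated_annotate X u p :
  annotated (annotate X u) p <-> X p /\ exists d, root_at u p = Some (inl d).
Proof.
rewrite /annotated /root_at.
elim: p u X => [|i p IH] [x|f args] X /=.
- by split=> [[]//|[_ []]//].
- case: f args => [d|c] args /=; last by split=> [[]//|[_ []]//].
  case: ifPn => [/asboolP h|/asboolP h] /=.
    by split=> _; [split=> //|]; exists d.
  by split=> [[]//|[/h]].
- by split=> [[]//|[_ []]//].
have -> : subterm_at (annotate X (App f args)) (i :: p) =
   if insub i is Some k then
     subterm_at (annotate [set p | X (val k :: p)] (args k)) p
   else None by case: f args => [d|c] args //=; case: ifP.
rewrite /=; case: insubP => [k _ ki|_] /=; last by split=> [[]//|[_ []]//].
by rewrite IH /= ki.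
Qed.

Lemma annotateK t : annotate (annotated t) (flat t) = t.
Proof.
elim: t => [x|f args IH] //=.
have IH' : (fun i => annotate [set p | annotated (App f args) (val i :: p)]
                       (flat (args i))) = args.
  apply/funext => i; rewrite -[RHS]IH; congr annotate; apply/funext => p.
  by rewrite /annotated /root_at /= valK.
case: f args IH IH' => [[d|c]|d] args IH /= -> //.
  by case: ifPn => // /asboolP [].
by case: ifPn => // /asboolP []; exists d.
Qed.

(** [flat_result] and [annotated_result] compute both premises, so results of steps can be compared
    without unfolding [case_result]. *)
Lemma aterm_ext s t : flat s = flat t ->
  (forall p, annotated s p <-> annotated t p) -> s = t.
Proof.
move=> st h; rewrite -(annotateK s) -(annotateK t) st; congr annotate.
by apply/funext => p; apply/propext.
Qed.

(** The flag and the annotation at the redex determine the case, so the four cases can be treated as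
    one. *)
Definition case_of t p (m : bool) : rewrite_case :=
  if `[< annotated t p >] then (if m then case_pr else case_p)
  else (if m then case_r else case_irr).

Lemma case_appliesE c t p m : case_applies c t p m <-> c = case_of t p m.
Proof.
rewrite /case_of; case: ifPn => /asboolP; rewrite -pos_DsharpE => h;
  by case: m; case: c => /=; split=> //; try (by case); try (by move=> _; split).
Qed.

Definition result (m : bool) t p (sg : V -> uterm D C V) (r : aterm D C V) :=
  case_result (case_of t p m) t p sg r.

Lemma flat_result m t p sg r :
  flat (result m t p sg r) = replace_at (flat t) p (subst sg (flat r)).
Proof.
rewrite /result /case_of; case: ifP => _; case: m => /=;
  by rewrite ?flat_flat_above flat_replace ?flat_emb ?flat_subst.
Qed.

Lemma annotated_replace t p s q : subterm_at t p ->
  annotated (replace_at t p s) q <->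
  (annotated t q /\ ~~ prefix p q) \/ exists2 q', q = p ++ q' & annotated s q'.
Proof.
move=> tp; rewrite {1}/annotated.
case: (boolP (prefix p q)) => [/prefixP [q' ->]|npq].
  rewrite /root_at subterm_at_replace_cat //.
  split=> [h|[[_ //]|[q'' /eqP]]]; first by right; exists q'.
  by rewrite eqseq_cat // eqxx /= => /eqP <-.
rewrite root_at_replace //; split=> [h|[[]//|]]; first by left.
by move=> [q' e]; move: npq; rewrite e prefix_prefix.
Qed.

(** The substitution carries no annotations, so those inside the contractum come from [r], and
    [flat r] supplies none. The others belong to the context, where only a [false] flag clears those
    above [p]. *)
Lemma annotated_result m t p sg r q : subterm_at t p ->
  annotated (result m t p sg r) q <->
  [/\ annotated t q, ~~ prefix p q & m = false -> ~~ prefix q p] \/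
  (annotated t p /\ exists2 q', q = p ++ q' & annotated r q').
Proof.
move=> tp; rewrite /result /case_of.
(* The root of the contractum is not strictly above [p], so [flat_above] leaves its annotation
   alone. *)
have pq q' : prefix (p ++ q') p -> p ++ q' = p.
  move=> /size_prefix; rewrite size_cat -[X in (_ <= X)%N]addn0 leq_add2l.
  by case: q' => //; rewrite cats0.
have npp : ~~ prefix p q -> (prefix q p -> q = p) -> ~~ prefix q p.
  by move=> h1 h2; apply/negP => h; move: h1; rewrite (h2 h) prefix_refl.
case: ifPn => /asboolP an; case: m => /=;
  rewrite ?annotated_flat_above annotated_replace //.
- split=> [[[h1 h2]|[q' e h]]|[[h1 h2 _]|[_ [q' e h]]]].
  + by left.
  + by right; split=> //; exists q' => //; move/annotated_subst: h.
  + by left.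
  + by right; exists q' => //; apply/annotated_subst.
- split=> [[[[h1 h2]|[q' e h]] h3]|[[h1 h2 h3]|[_ [q' e h]]]].
  + by left; split=> // _; exact: npp.
  + by right; split=> //; exists q' => //; move/annotated_subst: h.
  + by split; [left|rewrite (negbTE (h3 erefl))].
  + split; first by right; exists q' => //; apply/annotated_subst.
    by rewrite e; exact: pq.
- split=> [[[h1 h2]|[q' e /annotated_emb //]]|[[h1 h2 _]|[]//]]; by left.
- split=> [[[[h1 h2]|[q' e /annotated_emb //]] h3]|[[h1 h2 h3]|[]//]].
  + by left; split=> // _; exact: npp.
  + by split; [left|rewrite (negbTE (h3 erefl))].
Qed.

End Annotations.

(** * Steps described by redexes *)

Section Rewriting.
Variables (R : realType) (D C : signature) (V : Type).
Implicit Types (P : set (adp R D C V)) (t s : aterm D C V) (u : uterm D C V).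

Definition redex P u (a : adp R D C V) (sg : V -> uterm D C V) (p : seq nat) :=
  [/\ P a, subterm_at u p = Some (subst sg (lhs a)) &
      ANF P (emb (subst sg (lhs a)))].

Lemma redex_subterm P t a sg p : redex P (flat t) a sg p -> subterm_at t p.
Proof. by case=> _; rewrite subterm_at_flat; case: subterm_at. Qed.

Lemma rewritesE P c t mu : (forall a, P a -> is_adp a) ->
  rewrites P c t mu <->
  exists a sg p, [/\ redex P (flat t) a sg p, c = case_of t p (flag a) &
    mu = seq_mset [seq (x.1, result (flag a) t p sg x.2) | x <- rhs a]].
Proof.
move=> adpP; split=> [[a [sg [p [Pa _ [tp nf] /case_appliesE -> ->]]]]|].
  by exists a, sg, p; split=> //; split=> //; rewrite subterm_at_flat.
move=> [a [sg [p [[Pa tp nf] -> ->]]]]; exists a, sg, p; split=> //.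
(* A left-hand side has a defined root, hence so has the redex. *)
- rewrite pos_DE /root_at tp /=.
  have [[d rl] _ _] := adpP a Pa; exists d.
  by case: (lhs a) rl => //= f args [->].
- by rewrite -subterm_at_flat.
- exact/case_appliesE.
Qed.

Lemma annotated_rewritesE P t mu : (forall a, P a -> is_adp a) ->
  (rewrites P case_pr t mu \/ rewrites P case_p t mu) <->
  exists a sg p, [/\ redex P (flat t) a sg p, annotated t p &
    mu = seq_mset [seq (x.1, result (flag a) t p sg x.2) | x <- rhs a]].
Proof.
move=> adpP; rewrite !rewritesE //; split.
  move=> [] [a [sg [p [h1 h2 h3]]]]; exists a, sg, p; split=> //;
  by move: h2; rewrite /case_of; case: asboolP => //; case: (flag a).
move=> [a [sg [p [h1 h2 h3]]]].
case e: (flag a); [left|right]; exists a, sg, p; split=> //;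
  by rewrite /case_of e asboolT.
Qed.

Lemma unannotated_rewritesE P t mu : (forall a, P a -> is_adp a) ->
  (rewrites P case_r t mu \/ rewrites P case_irr t mu) <->
  exists a sg p, [/\ redex P (flat t) a sg p, ~ annotated t p &
    mu = seq_mset [seq (x.1, result (flag a) t p sg x.2) | x <- rhs a]].
Proof.
move=> adpP; rewrite !rewritesE //; split.
  move=> [] [a [sg [p [h1 h2 h3]]]]; exists a, sg, p; split=> //;
  by move: h2; rewrite /case_of; case: asboolP => //; case: (flag a).
move=> [a [sg [p [h1 h2 h3]]]].
case e: (flag a); [left|right]; exists a, sg, p; split=> //;
  by rewrite /case_of e asboolF.
Qed.

End Rewriting.

(** * Usable symbols and guarded terms *)

Section Usability.
Variables (R : realType) (D C : signature) (V : Type).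
Variable (P : set (adp R D C V)).
Hypothesis adpP : forall a, P a -> is_adp a.
Implicit Types (t s : aterm D C V) (u : uterm D C V).

Definition plain_nf u :=
  ~ exists q a sg, P a /\ subterm_at u q = Some (subst sg (lhs a)).

Lemma plain_nf_subterm u q u' :
  plain_nf u -> subterm_at u q = Some u' -> plain_nf u'.
Proof.
move=> nfu uq [q' [a [sg [Pa h]]]]; apply: nfu.
by exists (q ++ q'), a, sg; rewrite subterm_at_cat uq.
Qed.

Lemma ANF_subterm u i q u' :
  ANF P (emb u) -> subterm_at u (i :: q) = Some u' -> plain_nf u'.
Proof.
move=> /(_ (i :: q) (emb u')) nf e.
have := nf _ _; rewrite /normal_form flat_emb; apply=> //.
by rewrite subterm_at_emb e.
Qed.

(** As [lhs a] has a defined root, its variables sit at proper positions, so their images are proper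
    subterms of a redex in [ANF]. *)
Lemma redex_subst_nf u a sg p x :
  redex P u a sg p -> vars (lhs a) x -> plain_nf (sg x).
Proof.
move=> [Pa _ nf] /(@vars_subterm_at _ _ _ _) [q hq].
have [[d rl] _ _] := adpP Pa.
case: q hq => [|i q] hq; first by move: rl hq; case: (lhs a).
apply: (ANF_subterm (i := i) (q := q) nf).
by rewrite (subterm_at_subst sg hq).
Qed.

(** The second clause makes the property hereditary: by [usable_symbol_at] it passes to the symbols
    in right-hand sides of the flag-[true] rules for [f]. *)
Definition usable_symbol (f : sigU D C) :=
  Rules P (inl f) `<=` usable_rules P /\
  forall b r, Rules P (inl f) b -> supp (rhs b) r ->
    usable_term P (emb (flat r)) `<=` usable_rules P.

Lemma usable_symbol_at u q f :
  usable_term P (emb u) `<=` usable_rules P -> root_at u q = Some f ->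
  usable_symbol f.
Proof.
rewrite /root_at; elim: q u => [|i q IH] [x|g args] //= us.
  case=> <-; split=> [a|b r] Ra; first by apply: us; exact: usable_root.
  by move=> br a ra; apply: us; apply: usable_rhs Ra br ra.
case: insubP => //= j _ ji; apply: IH => a ua; apply: us.
exact: (@usable_arg _ _ _ _ _ (inl g) (fun k => emb (args k)) j).
Qed.

(** The usable rules of the arguments below the annotation are collected by [usable_arg]. The
    annotated symbol itself has no rules, which is why the position is strictly below it. *)
Lemma usable_symbol_below_sharp b r q i q' f : P b -> supp (rhs b) r ->
  annotated r q -> root_at (flat r) (q ++ i :: q') = Some f -> usable_symbol f.
Proof.
move=> Pb br [?]; rewrite /root_at.
case e: (subterm_at r q) => [[x|[g|d] args]|] //= _.
rewrite subterm_at_cat subterm_at_flat e /=.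
case: insubP => //= j _ _ hf.
apply: (@usable_symbol_at (flat (args j)) q') => // a ua.
exists b, r, (flat (@App (sharp D C) V (inr d) args)); split=> //.
  exists q; last by rewrite e.
  by apply/pos_DsharpE; exists d; rewrite /root_at e.
exact: (@usable_arg _ _ _ _ _ (inr d) (fun k => emb (flat (args k))) j).
Qed.

Definition guarded s := forall p i q f, annotated s p ->
  root_at (flat s) (p ++ i :: q) = Some f ->
  (exists2 u, subterm_at (flat s) (p ++ i :: q) = Some u & plain_nf u) \/
  usable_symbol f.

Lemma redex_not_nf u a sg p q v : redex P u a sg (p ++ q) ->
  subterm_at u p = Some v -> ~ plain_nf v.
Proof.
move=> [Pa h _] up; apply; exists q, a, sg; split=> //.
by move: h; rewrite subterm_at_cat up.
Qed.

(** An instance of a left-hand side is no normal form, which leaves only the second alternative of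
    [guarded]. *)
Lemma guarded_redex s a sg p i q : guarded s ->
  redex P (flat s) a sg (p ++ i :: q) -> annotated s p ->
  exists2 f, root (lhs a) = Some f & usable_symbol f.
Proof.
move=> gs rx anp; have [Pa h _] := rx; have [[d rl] _ _] := adpP Pa.
exists (inl d) => //.
have [] := gs p i q (inl d) anp; last by [].
  by rewrite /root_at h; case: (lhs a) rl => //= f args [->].
move=> [u hu nfu]; exfalso.
by move: rx; rewrite -[p ++ i :: q]cats0 => /redex_not_nf /(_ hu).
Qed.

Lemma prefix_comparable (T : eqType) (p q s : seq T) :
  prefix p s -> prefix q s -> prefix p q || prefix q p.
Proof.
elim: s p q => [|x s IH] [|y p] [|z q] //=.
by move=> /andP[/eqP -> ps] /andP[/eqP -> qs]; rewrite eqxx /= IH.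
Qed.

Lemma guarded_result s a sg p r : guarded s -> redex P (flat s) a sg p ->
  supp (rhs a) r -> guarded (result (flag a) s p sg r).
Proof.
move=> gs rx ar p0 i q f; have sp := redex_subterm rx.
have [Pa hp _] := rx; have [_ _ /(_ _ ar) vr] := adpP Pa.
have sp' : subterm_at (flat s) p by rewrite hp.
have rhs_ok q' g : root_at (subst sg (flat r)) q' = Some g ->
    root_at (flat r) q' = Some g \/
    exists2 u, subterm_at (subst sg (flat r)) q' = Some u & plain_nf u.
  move=> /root_at_subst [|[x [q'' [u [xr h1 h2]]]]]; first by left.
  right; exists u => //; apply: plain_nf_subterm h1.
  by apply: redex_subst_nf rx _; apply: vr; rewrite -vars_flat.
rewrite annotated_result // flat_result.
(* An annotation of the result is either an old one of the context or a new one from [r]. Below a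
   new one, every symbol comes from [r] or lies in a normal form. *)
move=> [[anp0 npp0 fl]|[anp [q0 -> anq0]]]; last first.
  rewrite -catA /root_at subterm_at_replace_cat // => /rhs_ok [h|]; last by left.
  by right; apply: usable_symbol_below_sharp Pa ar anq0 h.
(* If the symbol is inside the contractum, the old annotation lies above the redex. It survived only
   because the flag is [true], and the root of the applied rule is usable. *)
case: (boolP (prefix p (p0 ++ i :: q))) => [pp|npp].
  have p0p : prefix p0 p.
    have := prefix_comparable pp (prefix_prefix p0 (i :: q)).
    by rewrite (negbTE npp0).
  have flt : flag a = true.
    by case e: (flag a) => //; move: (fl e); rewrite p0p.
  case/prefixP: p0p => -[|j z] ep; first by rewrite ep cats0 prefix_refl in npp0.
  have [g rg [_ ug]] : exists2 g, root (lhs a) = Some g & usable_symbol g.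
    by apply: (@guarded_redex s a sg p0 j z) => //; rewrite -ep.
  case/prefixP: pp => q' ->.
  rewrite /root_at subterm_at_replace_cat // => /rhs_ok [h|]; last by left.
  right; apply: usable_symbol_at h; apply: ug ar; split=> //.
  by case: (lhs a) rg => //= h args [->].
(* The symbol is outside the contractum. A normal form at its position cannot contain the redex, so
   it is parallel to [p] and unchanged. *)
rewrite root_at_replace // => rf.
have [[u hu nfu]|] := gs p0 i q f anp0 rf; last by right.
left; exists u => //; rewrite subterm_at_replace_par //.
apply/negP => /prefixP [z ez].
by move: rx; rewrite ez => /redex_not_nf /(_ hu).
Qed.

Lemma usable_rules_flag a : usable_rules P a -> P a /\ flag a = true.
Proof.
move=> [b [r [t [_ _ _]]]]; elim=> // f args {}a [] //.
Qed.

Lemma usable_rules_proc_origin a : usable_rules_proc P a ->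
  exists2 b, P b & [/\ lhs a = lhs b, rhs a = rhs b & flag a -> flag b].
Proof.
move=> [/usable_rules_flag [Pa _]|[b [Pb _] <-]]; first by exists a.
by exists b.
Qed.

Lemma usable_rules_proc_image a : P a ->
  exists2 b, usable_rules_proc P b & [/\ lhs b = lhs a, rhs b = rhs a,
    flag b -> flag a & flag a -> ~~ flag b -> ~ usable_rules P a].
Proof.
move=> Pa; have [ua|nua] := pselect (usable_rules P a).
  by exists a; [left|split=> // ->].
by exists (Adp (lhs a) (rhs a) false); [right; exists a|].
Qed.

Lemma ANF_usable_rules_proc t : ANF (usable_rules_proc P) t <-> ANF P t.
Proof.
have e s : normal_form (usable_rules_proc P) s <-> normal_form P s.
  split=> nf [p [a [sg [Pa h]]]]; apply: nf.
    have [b Pb [e _ _ _]] := usable_rules_proc_image Pa.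
    by exists p, b, sg; rewrite e.
  have [b Pb [e _ _]] := usable_rules_proc_origin Pa.
  by exists p, b, sg; rewrite -e.
by split=> nf p u p0 up; apply/e; exact: nf up.
Qed.

(* A non-usable rule is never applied below an annotation of a guarded term, so
   clearing its flag does not change the result. *)
Lemma guarded_simulation s a sg p : guarded s -> redex P (flat s) a sg p ->
  exists b, [/\ redex (usable_rules_proc P) (flat s) b sg p, rhs b = rhs a &
    forall r, result (flag b) s p sg r = result (flag a) s p sg r].
Proof.
move=> gs rx; have sp := redex_subterm rx; have [Pa hp nf] := rx.
have [b Pb [el er fba nus]] := usable_rules_proc_image Pa.
exists b; split=> //; first by split; rewrite ?el //; apply/ANF_usable_rules_proc.
move=> r; apply: aterm_ext => [|q]; first by rewrite !flat_result.
rewrite !annotated_result //.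
(* What remains is a [true] flag cleared in [b]. An annotation strictly above [p] would make the
   root of [lhs a] a usable symbol and [a] a usable rule, against [nus]. *)
case fa: (flag a) fba nus; case: (flag b) => // fba nus; last by have := fba isT.
split=> -[[h1 h2 h3]|h]; try (by right); left; split=> // _.
apply/negP => /prefixP [[|i z] ez]; first by rewrite ez cats0 prefix_refl in h2.
have [f rf [uf _]] : exists2 f, root (lhs a) = Some f & usable_symbol f.
  by apply: (@guarded_redex s a sg q i z) => //; rewrite -ez.
apply: nus => //; apply: uf; split=> //.
by case: (lhs a) rf => //= h args [->].
Qed.

End Usability.

(** * Chain trees: paths, chosen steps and leaf weight *)

Lemma perm_map_lift (A : eqType) (B : eqType) (g : A -> B) (s : seq A) (l : seq B) :
  perm_eq l (map g s) -> exists2 s', perm_eq s s' & map g s' = l.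
Proof.
case: s => [|x s].
  by move=> /perm_nilP ->; exists [::].
move=> /(perm_iotaP (g x)) [Is]; rewrite size_map => hI ->.
exists (map (nth x (x :: s)) Is).
  by rewrite perm_sym; apply/(perm_iotaP x); exists Is.
rewrite -map_comp; apply/eq_in_map => i iI.
rewrite [LHS]/= -(nth_map x (g x)) //.
by move: iI; rewrite (perm_mem hI) mem_iota.
Qed.

Section Paths.
Variables (N : choiceType) (V : set N) (E : rel N) (r : N).
Hypothesis hV : directed_tree V E r.

Lemma path_node v q : V v -> path E v q -> V (last v q).
Proof.
have [_ EV _] := hV.
by elim: q v => //= w q IH v _ /andP[/EV [_ Vw]]; exact: IH.
Qed.

(** Prepending the path from the root to [v] reduces this to the uniqueness of paths from the
    root. *)
Lemma tree_path_inj v q q' : V v -> path E v q -> path E v q' ->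
  last v q = last v q' -> q = q'.
Proof.
move=> Vv pq pq' e; have [_ _ uni] := hV.
have [q0 [[p0 l0] _]] := uni v Vv.
have [z [_ uz]] := uni _ (path_node Vv pq).
have h1 : z = q0 ++ q by apply: uz; rewrite cat_path p0 last_cat l0.
have h2 : z = q0 ++ q' by apply: uz; rewrite cat_path p0 last_cat l0 e.
by move/eqP: h2; rewrite h1 eqseq_cat // eqxx => /eqP.
Qed.

End Paths.

Section ChainTrees.
Variables (R : realType) (D C : signature) (V : Type) (N : choiceType).
Variables (P : set (adp R D C V)) (T : tree R D C V N).
Hypothesis adpP : forall a, P a -> is_adp a.
Hypothesis ctT : chain_tree P T.

Record step_data := StepData {
  sd_rule : adp R D C V;
  sd_subst : V -> uterm D C V;
  sd_pos : seq nat;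
  sd_rhs : N -> aterm D C V
}.

(* [sd_rhs d w] is the right-hand side alternative that produced the child w. *)
Definition valid_step (v : N) (d : step_data) :=
  [/\ redex P (flat (ct_term T v)) (sd_rule d) (sd_subst d) (sd_pos d),
      ct_P T v <-> annotated (ct_term T v) (sd_pos d),
      forall w, ct_edge T v w -> ct_term T w =
        result (flag (sd_rule d)) (ct_term T v) (sd_pos d) (sd_subst d)
               (sd_rhs d w) &
      perm_eq (rhs (sd_rule d))
        [seq (ct_prob T w / ct_prob T v, sd_rhs d w)
        | w <- fset_set (ct_children T v)]].

Lemma mem_children v w : ct_node T v ->
  (w \in fset_set (ct_children T v)) = ct_edge T v w.
Proof.
move=> Tv; rewrite in_fset_set; last exact: (ct_finite ctT).
by apply/idP/idP; rewrite inE.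
Qed.

(** [ct_step] fixes the children only as a multiset of labels; [perm_map_lift] turns this into a
    matching of the children with the alternatives of the rule. *)
Lemma valid_step_ex v : ct_inner T v -> exists d, valid_step v d.
Proof.
move=> iv; have [Tv _] := iv.
have : exists a sg p, [/\ redex P (flat (ct_term T v)) a sg p,
    ct_P T v <-> annotated (ct_term T v) p & ct_step T v =
    seq_mset [seq (x.1, result (flag a) (ct_term T v) p sg x.2) | x <- rhs a]].
  have [Pv|nPv] := pselect (ct_P T v).
    have /(annotated_rewritesE _ _ adpP) [a [sg [p [h1 h2 h3]]]] := ct_P_step ctT Pv.
    by exists a, sg, p.
  have Rv : ct_R T v by [].
  have /(unannotated_rewritesE _ _ adpP) [a [sg [p [h1 h2 h3]]]] := ct_R_step ctT Rv.
  by exists a, sg, p.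
move=> [a [sg [p [rx Pv /eq_seq_msetP]]]].
set ch : seq N := fset_set (ct_children T v).
move=> /perm_map_lift [l al el].
have sl : size l = size ch by have := congr1 size el; rewrite !size_map.
pose x0 : R * aterm D C V := (0, ct_term T v).
have uch : uniq ch by exact: fset_uniq.
have nthl w : w \in ch -> (ct_prob T w / ct_prob T v, ct_term T w) =
    ((nth x0 l (index w ch)).1, result (flag a) (ct_term T v) p sg
                                  (nth x0 l (index w ch)).2).
  move=> wch; have iw : (index w ch < size ch)%N by rewrite index_mem.
  have := congr1 (fun z => nth x0 z (index w ch)) el.
  rewrite (nth_map x0) ?sl // (nth_map w) // nth_index // => <- //.
(* [l] follows the order of the children, so each child takes the alternative at its own index and
   never the default [x0]. *)
exists (StepData a sg p (fun w => (nth x0 l (index w ch)).2)); split=> //=.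
  move=> w vw; have : w \in ch by rewrite mem_children.
  by move=> /nthl [].
rewrite -/ch; suff -> : [seq (ct_prob T w / ct_prob T v, (nth x0 l (index w ch)).2)
  | w <- ch] = l by [].
apply: (@eq_from_nth _ x0); rewrite size_map ?sl // => i ich.
have ww : nth v ch i \in ch by rewrite mem_nth.
rewrite (nth_map v) //; have [-> _] := nthl _ ww.
by rewrite index_uniq //; case: nth.
Qed.

Lemma valid_steps :
  exists sd, forall v, ct_inner T v -> valid_step v (sd v).
Proof.
have /choice [sd sdP] : forall v, exists d, ct_inner T v -> valid_step v d.
  move=> v; have [iv|niv] := pselect (ct_inner T v).
    by have [d hd] := valid_step_ex iv; exists d.
  by exists (StepData (Adp (flat (ct_term T v)) mset0 false) Var [::] (ct_term T)).
by exists sd.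
Qed.

Lemma rhs_child v d w : ct_inner T v -> valid_step v d -> ct_edge T v w ->
  (ct_prob T w / ct_prob T v, sd_rhs d w) \in rhs (sd_rule d).
Proof.
move=> [Tv _] [_ _ _ pe] vw; rewrite -[_ \in _]/(_ \in (rhs (sd_rule d) : seq _)).
rewrite (perm_mem pe); apply/mapP; exists w => //.
by rewrite mem_children.
Qed.

Lemma edge_inner v w : ct_edge T v w -> ct_inner T v.
Proof.
have [r [_ EV _] _] := ct_tree ctT.
by move=> vw; split; [case: (EV _ _ vw)|exists w].
Qed.

Lemma edge_node v w : ct_edge T v w -> ct_node T w.
Proof. by have [r [_ EV _] _] := ct_tree ctT; move=> /EV []. Qed.

Lemma prob_gt0 v : ct_node T v -> 0 < ct_prob T v.
Proof. by move=> /(ct_prob01 ctT) /andP[]. Qed.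

Lemma prob_edge v w : ct_edge T v w -> ct_prob T w <= ct_prob T v.
Proof.
move=> vw; have iv := edge_inner vw; have [d vd] := valid_step_ex iv.
have [[Pa _ _] _ _ _] := vd; have [_ [pos01 _] _] := adpP Pa.
have /pos01 /andP[_ /=] := rhs_child iv vd vw.
by rewrite ler_pdivrMr ?mul1r // prob_gt0 //; case: iv.
Qed.

Lemma prob_path v q : path (ct_edge T) v q -> ct_prob T (last v q) <= ct_prob T v.
Proof.
elim: q v => //= w q IH v /andP[/prob_edge vw /IH h]; exact: le_trans h vw.
Qed.

Lemma prob_children v : ct_inner T v ->
  \sum_(w <- fset_set (ct_children T v)) ct_prob T w = ct_prob T v.
Proof.
move=> iv; have [d [[Pa _ _] _ _ pe]] := valid_step_ex iv.
have [_ [_ s1] _] := adpP Pa; have [Tv _] := iv.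
move: s1; rewrite (perm_big _ pe) /= big_map /= -mulr_suml => s1.
by apply: (divIf (lt0r_neq0 (prob_gt0 Tv))); rewrite s1 divff // lt0r_neq0 // prob_gt0.
Qed.

Definition reach v w := exists2 q, path (ct_edge T) v q & last v q = w.

(** Not normalised: the lower bound [ct_prob T v] says that the subtree at [v] loses no
    probability. *)
Definition leaf_weight_below v : \bar R :=
  (\esum_(w in [set w | ct_leaf T w /\ reach v w]) (ct_prob T w)%:E)%E.

(** Induction on the depth bound: the probability of [v] is shared out among its children, and a
    leaf reached from [v] by a nonempty path is reached from a child by a shorter one. *)
Lemma leaf_sum_le (F : seq N) n v : uniq F -> (forall w, w \in F -> ct_leaf T w) ->
  ct_node T v ->
  \sum_(w <- F | `[< exists q, [/\ path (ct_edge T) v q, last v q = w &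
                                 (size q < n)%N] >]) ct_prob T w <= ct_prob T v.
Proof.
move=> uF lF; elim: n v => [|n IH] v Tv.
  rewrite big_pred0; first exact/ltW/prob_gt0.
  by move=> w; apply/asboolP => -[q []].
have p0 w : w \in F -> 0 <= ct_prob T w.
  by move=> /lF [Tw _]; exact/ltW/prob_gt0.
(* A node that is not inner reaches only itself. *)
have [iv|niv] := pselect (ct_inner T v); last first.
  rewrite big_mkcond /= (@le_trans _ _ (\sum_(w <- F | w == v) ct_prob T w)) //.
    rewrite [leRHS]big_mkcond /= big_seq [leRHS]big_seq; apply: ler_sum => w wF.
    case: asboolP => [[[|y q] /= [pq lq _]]|_].
    - by rewrite -lq eqxx.
    - by exfalso; apply: niv; apply: (@edge_inner _ y); case/andP: pq.
    - by case: eqP => // _; exact: p0.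
  case: (boolP (v \in F)) => vF; last first.
    rewrite big_seq_cond big_pred0 ?(ltW (prob_gt0 Tv)) // => w.
    by apply/negbTE; apply/negP => /andP[wF /eqP wv]; rewrite wv (negbTE vF) in wF.
  by rewrite -big_filter filter_pred1_uniq // big_seq1.
rewrite -(prob_children iv).
apply: (@le_trans _ _ (\sum_(u <- fset_set (ct_children T v))
   \sum_(w <- F | `[< exists q, [/\ path (ct_edge T) u q, last u q = w &
                                  (size q < n)%N] >]) ct_prob T w)); last first.
  rewrite big_seq [leRHS]big_seq; apply: ler_sum => u.
  by rewrite mem_children // => /edge_node; exact: IH.
under [leRHS]eq_bigr do rewrite big_mkcond /=.
rewrite exchange_big /= big_mkcond /= big_seq [leRHS]big_seq.
apply: ler_sum => w wF; case: asboolP => [[[|u q] /= [pq lq sq]]|_].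
- by exfalso; have [_] := lF w wF; apply; rewrite -lq.
- case/andP: pq => vu pq.
  (* The summand of the child [u] on the path already accounts for [w]; the others are
     nonnegative. *)
  rewrite (big_fsetD1 u) /=; last by rewrite mem_children.
  rewrite asboolT; last by exists q.
  by rewrite lerDl sumr_ge0 // => z _; case: ifP => // _; exact: p0.
- by rewrite sumr_ge0 // => z _; case: ifP => // _; exact: p0.
Qed.

(** The weight is a supremum of finite sums, and finitely many leaves have bounded depth. *)
Lemma leaf_weight_le1 : (leaf_weight T <= 1%:E)%E.
Proof.
have [r hr pr1] := ct_tree ctT; have [Tr _ uni] := hr.
apply: ge_ereal_sup => _ [X [finX XL] <-].
rewrite fsbig_finite //= sumEFin lee_fin -pr1.
have XL' w : w \in fset_set X -> ct_leaf T w.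
  by rewrite in_fset_set // inE => /XL.
have bounded (l : seq N) : (forall w, w \in l -> ct_node T w) ->
    exists n, forall w, w \in l ->
    exists q, [/\ path (ct_edge T) r q, last r q = w & (size q < n)%N].
  elim: l => [|w l IH] hl; first by exists 0%N.
  have [|n hn] := IH; first by move=> u ul; apply: hl; rewrite inE ul orbT.
  have [q [[pq lq] _]] := uni w (hl _ (mem_head _ _)).
  exists (maxn n (size q).+1) => u; rewrite inE => /predU1P[->|/hn [q' [p' l' s']]].
    by exists q; split=> //; rewrite leq_max ltnS leqnn orbT.
  by exists q'; split=> //; rewrite leq_max s'.
have [|n hn] := bounded (fset_set X); first by move=> w /XL' [].
apply: le_trans (leaf_sum_le n _ XL' Tr); last exact: fset_uniq.
rewrite big_seq [leRHS]big_mkcond [leRHS]big_seq; apply: ler_sum => w wX.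
by rewrite asboolT //; exact: hn.
Qed.

Lemma leaf_weight_below_leaf w : ct_leaf T w ->
  ((ct_prob T w)%:E <= leaf_weight_below w)%E.
Proof.
move=> lw; apply: esum_ge; exists [set w]; last by rewrite fsbig_set1.
by split; [exact: finite_set1|move=> _ ->; split=> //; exists [::]].
Qed.

(** The upper bound is [leaf_weight_le1], so only the lower bound is ever at stake. *)
Lemma leaf_weight_from_root r : directed_tree (ct_node T) (ct_edge T) r ->
  ct_prob T r = 1 -> ((ct_prob T r)%:E <= leaf_weight_below r)%E ->
  leaf_weight T = 1%:E.
Proof.
move=> hr -> h; apply/eqP; rewrite eq_le leaf_weight_le1 /=.
apply: le_trans h _; rewrite /leaf_weight_below /leaf_weight.
rewrite (_ : [set w | _] = ct_leaf T) //; apply/seteqP; split=> w /=; first by case.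
move=> lw; split=> //; have [_ _ uni] := hr; case: lw => Tw _.
by have [q [[pq lq] _]] := uni w Tw; exists q.
Qed.

End ChainTrees.

(** * Replaying a cut chain tree with another set of rules *)

Section Simulation.
Variables (R : realType) (D C : signature) (V : Type) (N : choiceType).
Variables (P Q : set (adp R D C V)) (T : tree R D C V N).
Hypothesis adpP : forall a, P a -> is_adp a.
Hypothesis adpQ : forall a, Q a -> is_adp a.
Hypothesis ctT : chain_tree P T.
Variables (sd : N -> step_data R D C V N).
Hypothesis sdP : forall v, ct_inner T v -> valid_step P T v (sd v).
(** The replay is cut where [stop] holds of a node and its new term; [I] relates the old term of a
    node to the new one. *)
Variables (stop : N -> aterm D C V -> Prop) (I : aterm D C V -> aterm D C V -> Prop).
Variables (v0 : N) (s0 : aterm D C V).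
Hypothesis Tv0 : ct_node T v0.
Hypothesis I0 : I (ct_term T v0) s0.

Local Notation A v := (sd_rule (sd v)).
Local Notation sg v := (sd_subst (sd v)).
Local Notation ps v := (sd_pos (sd v)).

(** The implication between annotations keeps the replayed nodes of [ct_P T] in [ct_P] of the
    replay, whence infinitely many of them on every infinite path. *)
Definition simulates v s (b : adp R D C V) :=
  [/\ redex Q (flat s) b (sg v) (ps v), rhs b = rhs (A v),
      annotated (ct_term T v) (ps v) -> annotated s (ps v) &
      forall r, supp (rhs (A v)) r ->
        I (result (flag (A v)) (ct_term T v) (ps v) (sg v) r)
          (result (flag b) s (ps v) (sg v) r)].

Hypothesis simI : forall v s, ct_inner T v -> ~ stop v s -> I (ct_term T v) s ->
  exists b, simulates v s b.

(* The tree T is cut below the stopped nodes of the subtree at [v0], and its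
   nodes are relabelled by replaying the steps of T from [s0]. *)
Lemma simulation_tree : exists T' : tree R D C V N,
  [/\ chain_tree Q T', ct_prob T' = (fun w => ct_prob T w / ct_prob T v0),
      (forall w, ct_node T' w -> ct_node T w /\ I (ct_term T w) (ct_term T' w)),
      (forall w, ct_leaf T' w -> ct_leaf T w \/ stop w (ct_term T' w)) &
      (forall w, ct_node T' w ->
         exists2 q, path (ct_edge T) v0 q /\ last v0 q = w &
           forall q1 y q2, q = q1 ++ y :: q2 -> ct_inner T' (last v0 q1))].
Proof.
have [r hr _] := ct_tree ctT.
have /choice [B BP] : forall vs : N * aterm D C V, exists b,
    ct_inner T vs.1 -> ~ stop vs.1 vs.2 -> I (ct_term T vs.1) vs.2 ->
    simulates vs.1 vs.2 b.
  move=> [v s] /=.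
  have [[[iv ns] iI]|h] := pselect ((ct_inner T v /\ ~ stop v s) /\ I (ct_term T v) s).
    by have [b hb] := simI iv ns iI; exists b.
  by exists (A v) => iv ns iI; case: h.
pose F v w s := result (flag (B (v, s))) s (ps v) (sg v) (sd_rhs (sd v) w).
pose replay := fix replay v s q :=
  if q is w :: q' then replay w (F v w s) q' else s.
have replay_rcons v s q w :
    replay v s (rcons q w) = F (last v q) w (replay v s q).
  by elim: q v s => //= u q IH v s; rewrite IH.
(* The new term of [x] is computed along the path from [v0], which is unique by [tree_path_inj]. *)
pose lab x := replay v0 s0 (xget [::] [set q | path (ct_edge T) v0 q /\ last v0 q = x]).
have labE q : path (ct_edge T) v0 q -> lab (last v0 q) = replay v0 s0 q.
  move=> pq; rewrite /lab; case: xgetP => [q' -> [pq' lq']|/(_ q) []//].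
  by congr replay; exact: (tree_path_inj hr Tv0 pq' pq lq').
(* A stopped node loses all its outgoing edges and any other keeps all of them, so every inner node
   of the cut tree has a complete step. *)
pose live u w := ct_edge T u w && ~~ `[< stop u (lab u) >].
have liveW : subrel live (ct_edge T) by move=> u w /andP[].
pose nodes : set N := [set x | exists2 q, path live v0 q & last v0 q = x].
pose edge u w := `[< nodes u >] && live u w.
have edge_live : subrel edge live by move=> u w /andP[].
pose inner : set N := [set v | nodes v /\ exists w, edge v w].
(* Dividing by the probability of [v0] gives the new root probability 1 and keeps the ratios along
   edges. *)
pose T' := Tree nodes edge (fun w => ct_prob T w / ct_prob T v0) lab
  [set v | inner v /\ annotated (lab v) (ps v)].
have nodes0 : nodes v0 by exists [::].
have nodesS v w : nodes v -> live v w -> nodes w.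
  move=> [q pq lq] vw; exists (rcons q w); last by rewrite last_rcons.
  by rewrite rcons_path pq lq.
have labS v w : nodes v -> ct_edge T v w -> lab w = F v w (lab v).
  move=> [q /(sub_path liveW) pq lq] vw.
  have pw : path (ct_edge T) v0 (rcons q w) by rewrite rcons_path pq lq.
  have := labE _ pw; rewrite last_rcons replay_rcons => ->.
  by rewrite -labE // lq.
have supp_child v w : ct_edge T v w -> supp (rhs (A v)) (sd_rhs (sd v) w).
  move=> vw; have iv := edge_inner ctT vw.
  by exists (ct_prob T w / ct_prob T v); exact: (rhs_child ctT iv (sdP iv) vw).
have nodesI w : nodes w -> ct_node T w /\ I (ct_term T w) (lab w).
  move=> [q pq <-]; elim/last_ind: q pq => [|q w' IH] /=.
    by move=> _; split=> //; have := labE [::] isT => /= ->.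
  rewrite rcons_path last_rcons => /andP[pq lw].
  have [Tv Iv] := IH pq; set v := last v0 q in lw Tv Iv *.
  have nv : nodes v by exists q.
  have vw := liveW _ _ lw; have iv := edge_inner ctT vw.
  split; first exact: (edge_node ctT vw).
  have ns : ~ stop v (lab v) by case/andP: lw => _ /asboolP.
  have [_ _ _ hI] := BP (v, lab v) iv ns Iv.
  rewrite (labS _ _ nv vw); have [_ _ /(_ _ vw) -> _] := sdP iv.
  exact: hI (supp_child _ _ vw).
have path_edge v q : nodes v -> path edge v q = path live v q.
  elim: q v => //= w q IH v nv; rewrite /edge asboolT //=.
  by case lw: (live v w) => //=; rewrite IH //; exact: nodesS lw.
have innerT v : inner v -> [/\ nodes v, ct_inner T v & ~ stop v (lab v)].
  move=> [nv [w /edge_live lw]]; split=> //.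
    exact: (edge_inner ctT (liveW _ _ lw)).
  by case/andP: lw => _ /asboolP.
have childrenE v : inner v -> [set w | edge v w] = ct_children T v.
  move=> /innerT [nv iv ns]; apply/seteqP; split=> w /=; first by move/edge_live/liveW.
  by move=> vw; rewrite /edge asboolT //= /live; apply/andP; split=> //; apply/asboolP.
have p0 : 0 < ct_prob T v0 by exact: (prob_gt0 ctT).
have stepE v : inner v -> ct_step T' v =
    seq_mset [seq (x.1, result (flag (B (v, lab v))) (lab v) (ps v) (sg v) x.2)
             | x <- rhs (B (v, lab v))].
  move=> iv; have [nv iTv ns] := innerT _ iv; have [Tv Iv] := nodesI _ nv.
  have [_ -> _ _] := BP (v, lab v) iTv ns Iv.
  apply/eq_seq_msetP; rewrite /ct_step /= /ct_children /= childrenE //.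
  have [_ _ _ pe] := sdP iTv.
  rewrite perm_sym; apply: perm_trans (perm_map _ pe) _; rewrite -map_comp.
  rewrite (_ : map _ _ =
    [seq (ct_prob T w / ct_prob T v0 / (ct_prob T v / ct_prob T v0), lab w)
    | w <- fset_set (ct_children T v)]) //.
  apply/eq_in_map => w; rewrite (mem_children ctT) // => vw /=.
  rewrite (labS _ _ nv vw) /F; congr pair.
  by rewrite invf_div mulrA divfK // lt0r_neq0.
exists T'; split=> //; last 2 first.
- move=> w [nw ninner]; have [Tw _] := nodesI _ nw.
  have [sw|nsw] := pselect (stop w (lab w)); first by right.
  left; split=> // -[_ [y wy]]; apply: ninner; split=> //; exists y.
  by rewrite /= /ct_children /= /edge asboolT //= /live; apply/andP; split=> //; apply/asboolP.
- move=> w [q pq lq]; exists q; first by split=> //; exact: sub_path pq.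
  move=> q1 y q2 eq; move: pq; rewrite eq cat_path /= => /and3P[p1 ly _].
  have n1 : nodes (last v0 q1) by exists q1.
  by split=> //; exists y; rewrite /ct_children /= /edge asboolT.
split=> /=.
- exists v0; last by rewrite divff // lt0r_neq0.
  split=> // [u w /andP[/asboolP nu lw]|w [q pq lq]].
    by split=> //; exact: nodesS lw.
  exists q; split; first by rewrite path_edge.
  move=> q' []; rewrite path_edge // => pq' lq'.
  apply: (tree_path_inj hr Tv0); [exact: sub_path pq|exact: sub_path pq'|].
  by rewrite lq lq'.
- move=> v nv; have [Tv _] := nodesI _ nv.
  apply: sub_finite_set (ct_finite ctT Tv) => w.
  by move=> /edge_live/liveW.
- move=> v nv; have [Tv _] := nodesI _ nv.
  rewrite divr_gt0 //=; last exact: (prob_gt0 ctT).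
  rewrite ler_pdivrMr // mul1r; case: nv => q pq <-.
  exact: (prob_path adpP ctT (sub_path liveW pq)).
- by move=> v [].
- move=> v [iv an]; apply/(annotated_rewritesE _ _ adpQ).
  have [nv iTv ns] := innerT _ iv; have [Tv Iv] := nodesI _ nv.
  have [h1 _ _ _] := BP (v, lab v) iTv ns Iv.
  by exists (B (v, lab v)), (sg v), (ps v); split=> //; exact: stepE.
- move=> v [iv nP]; apply/(unannotated_rewritesE _ _ adpQ).
  have [nv iTv ns] := innerT _ iv; have [Tv Iv] := nodesI _ nv.
  have [h1 _ _ _] := BP (v, lab v) iTv ns Iv.
  exists (B (v, lab v)), (sg v), (ps v); split=> //; last exact: stepE.
  by move=> an; apply: nP.
- move=> x ex; have := ct_inf ctT (fun n => liveW _ _ (edge_live _ _ (ex n))).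
  apply: sub_infinite_set => _ [[n _ <-] Pn]; split; first by exists n.
  have iv : inner (x n).
    by split; [have /andP[/asboolP] := ex n|exists (x n.+1)].
  have [nv iTv ns] := innerT _ iv; have [Tv Iv] := nodesI _ nv.
  have [_ _ han _] := BP (x n, lab (x n)) iTv ns Iv.
  by split=> //; apply: han; have [_ <- _ _] := sdP iTv.
Qed.

(** By [iAST Q] the leaves of the cut tree carry, in [T], the full probability of [v0]. Each is a
    leaf of [T] or a stopped node, to which the second premise applies, and the sets of leaves of
    [T] below them are disjoint. *)
Lemma simulation_leaf_weight : iAST Q ->
  (forall w s, ct_node T w -> I (ct_term T w) s -> stop w s ->
     ((ct_prob T w)%:E <= leaf_weight_below T w)%E) ->
  ((ct_prob T v0)%:E <= leaf_weight_below T v0)%E.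
Proof.
move=> astQ hstop; have [T' [ctT' pT' nT' lT' qT']] := simulation_tree.
have [r hr _] := ct_tree ctT.
have p0 : 0 < ct_prob T v0 by exact: (prob_gt0 ctT).
have pge0 w : ct_leaf T w -> (0 <= (ct_prob T w)%:E)%E.
  by move=> [Tw _]; rewrite lee_fin; exact/ltW/(prob_gt0 ctT).
have below w : ct_leaf T' w -> ((ct_prob T w)%:E <= leaf_weight_below T w)%E.
  move=> lw; have [Tw Iw] : ct_node T w /\ I (ct_term T w) (ct_term T' w).
    by apply: nT'; case: lw.
  have [lTw|sw] := lT' _ lw; first exact: leaf_weight_below_leaf.
  exact: hstop Iw sw.
have le1 : ((ct_prob T v0)%:E <= \esum_(w in ct_leaf T') (ct_prob T w)%:E)%E.
  have e0 : (0 <= \esum_(w in ct_leaf T') (ct_prob T w)%:E)%E.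
    apply: esum_ge0 => w [nw _]; rewrite lee_fin; apply/ltW/(prob_gt0 ctT).
    by case: (nT' _ nw).
  have := astQ _ _ ctT'; rewrite /leaf_weight pT' => e1.
  rewrite -[leLHS]mule1 -e1 muleC -lee_pdivlMr //.
  apply: ge_ereal_sup => _ [X [finX XL] <-].
  rewrite fsbig_finite //= sumEFin -mulr_suml EFinM lee_pmul2r //; last first.
    by rewrite lte_fin invr_gt0.
  by apply: esum_ge; exists X => //; rewrite fsbig_finite //= sumEFin.
apply: (le_trans le1); apply: (le_trans (le_esum below)).
rewrite /leaf_weight_below esum_esum; last by move=> i j _ [/pge0].
(* The sum runs over pairs of a cut leaf and a leaf of [T] below it; forgetting the cut leaf is
   injective. *)
rewrite -(esum_image _ snd (fun w => (ct_prob T w)%:E)).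
  apply: le_ereal_sup => _ [X [finX XI] <-]; exists X => //; split=> // x /XI.
  move=> [[w x'] [/= [nw _] [lx [q pq lq]]] <-]; split=> //.
  have [q1 [p1 l1] _] := qT' _ nw; exists (q1 ++ q).
    by rewrite cat_path p1 l1.
  by rewrite last_cat l1.
move=> [w1 x] [w2 x2]; rewrite !inE /= => -[lw1 [_ [q1 pq1 lq1]]] [lw2 [_ [q2 pq2 lq2]]] ex.
congr pair => //; subst x2.
have [z1 [pz1 lz1] i1] : exists2 q, path (ct_edge T) v0 q /\ last v0 q = w1 &
    forall q1 y q2, q = q1 ++ y :: q2 -> ct_inner T' (last v0 q1).
  by apply: qT'; case: lw1.
have [z2 [pz2 lz2] i2] : exists2 q, path (ct_edge T) v0 q /\ last v0 q = w2 &
    forall q1 y q2, q = q1 ++ y :: q2 -> ct_inner T' (last v0 q1).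
  by apply: qT'; case: lw2.
(* Two cut leaves above the same leaf [x] lie on one path, so one of [z1], [z2] is a prefix of the
   other; a proper prefix would end in an inner node of [T']. *)
have e : z1 ++ q1 = z2 ++ q2.
  by apply: (tree_path_inj hr Tv0);
    rewrite ?cat_path ?last_cat ?pz1 ?pz2 ?lz1 ?lz2 // lq1.
have : prefix z1 z2 || prefix z2 z1.
  by apply: (@prefix_comparable _ _ _ (z1 ++ q1)); rewrite ?prefix_prefix // e prefix_prefix.
case/orP => /prefixP [[|y z] ez].
- by rewrite -lz1 -lz2 ez cats0.
- by have [_] := lw1; rewrite -lz1; case; exact: i2 ez.
- by rewrite -lz1 -lz2 ez cats0.
- by have [_] := lw2; rewrite -lz2; case; exact: i1 ez.
Qed.

End Simulation.

(** * Completeness and soundness of the processor *)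

Section Processor.
Variables (R : realType) (D C : signature) (V : Type) (P : set (adp R D C V)).
Hypothesis hP : adp_problem P.

Let adpP : forall a, P a -> is_adp a := hP.2.
Let adpQ : forall a, usable_rules_proc P a -> is_adp a :=
  (usable_rules_proc_problem hP).2.

Lemma usable_rules_proc_complete : iAST P -> iAST (usable_rules_proc P).
Proof.
move=> astP N T ctT; have [r hr pr] := ct_tree ctT.
have [sd sdP] := valid_steps adpQ ctT.
pose I (t s : aterm D C V) :=
  flat s = flat t /\ forall p, annotated t p -> annotated s p.
apply: (leaf_weight_from_root adpQ ctT hr pr).
have [Tr _ _] := hr.
apply: (@simulation_leaf_weight R D C V N _ P T adpQ adpP ctT sd sdP
          (fun _ _ => False) I r (ct_term T r)) => //.
move=> v s iv _ [fs an]; have [rx _ _ _] := sdP v iv; have [Qa h nf] := rx.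
have tp := redex_subterm rx.
have [b Pb [el er fab]] := usable_rules_proc_origin Qa.
have rb : redex P (flat s) b (sd_subst (sd v)) (sd_pos (sd v)).
  by split; rewrite // -el ?fs //; apply/ANF_usable_rules_proc.
exists b; split=> //; first exact: an.
move=> x xr; split; first by rewrite !flat_result fs.
move=> p; rewrite !annotated_result //; last exact: (redex_subterm rb).
move=> [[h1 h2 h3]|[h1 h2]]; last by right; split=> //; exact: an.
left; split=> //; first exact: an.
(* A flag that is [false] in [P] is [false] in the processed problem too, so the replay clears no
   annotation that the given tree keeps. *)
by move=> fb; apply: h3; apply: contraFF fb.
Qed.

(** [l] bounds the positions where annotations of [t] are ignored in [s]; its length is the measure
    of the soundness proof. *)
Definition guarded_part (l : seq (seq nat)) (t s : aterm D C V) :=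
  [/\ flat s = flat t, forall p, annotated s p -> annotated t p,
      forall p, annotated t p -> annotated s p \/ p \in l & guarded P s].

(* When an annotation of [t] missing in [s] is rewritten, its subterm is in ANF,
   so [s] stays guarded after adding this annotation. *)
Lemma guarded_part_add l t s a sg p : guarded_part l t s ->
  redex P (flat t) a sg p -> annotated t p -> ~ annotated s p ->
  p \in l /\ exists s', guarded_part (rem p l) t s'.
Proof.
move=> [fs st ts gs] rx anp nanp; split; first by case: (ts p anp).
exists (annotate (fun q => annotated s q \/ q = p) (flat s)).
have def q : annotated t q -> exists d, root_at (flat s) q = Some (inl d).
  by move=> [d]; rewrite fs root_at_flat => ->; exists d.
split; first by rewrite flat_annotate.
- by move=> q /annotated_annotate [[/st //|->] _].
- move=> q tq; rewrite annotated_annotate.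
  have [->|qp] := eqVneq q p; first by left; split; [right|exact: def].
  have [sq|ql] := ts q tq; first by left; split; [left|exact: def].
  right; move: ql; rewrite (perm_mem (perm_to_rem (_ : p \in l))) ?inE ?(negbTE qp) //.
  by case: (ts p anp).
- move=> q i q' f /annotated_annotate [sq _]; rewrite flat_annotate.
  case: sq => [sq|->]; first exact: gs.
  have [_ hp nf] := rx; rewrite /root_at fs subterm_at_cat hp /=.
  case e: (subterm_at _ (i :: q')) => [u|] //= _.
  by left; exists u => //; exact: ANF_subterm nf e.
Qed.

Lemma usable_rules_proc_sound : iAST (usable_rules_proc P) -> iAST P.
Proof.
move=> astQ N T ctT; have [r hr pr] := ct_tree ctT; have [Tr _ _] := hr.
have [sd sdP] := valid_steps adpP ctT.
apply: (leaf_weight_from_root adpP ctT hr pr).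
have [l lP] := finite_positions (ct_term T r).
suff main n : forall l v s, (size l < n)%N -> ct_node T v ->
    guarded_part l (ct_term T v) s ->
    ((ct_prob T v)%:E <= leaf_weight_below T v)%E.
  (* The replay starts without annotations, hence vacuously guarded, and [l] covers all positions of
     the initial term. *)
  apply: (main (size l).+1 l r (emb (flat (ct_term T r)))) => //.
  split=> [|p /annotated_emb //|p [d]|p i q f /annotated_emb //].
    by rewrite flat_emb.
  rewrite /root_at => h; right; apply: lP.
  by move: h; case: subterm_at.
elim: n => [//|n IH] {lP}l v s ln Tv gp.
apply: (@simulation_leaf_weight R D C V N _ _ T adpP adpQ ctT sd sdP
  (fun w s => ct_P T w /\ ~ annotated s (sd_pos (sd w))) (guarded_part l) v s) => //.
  move=> {}v {}s {}Tv nstop {gp}[fs st ts gs].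
  have [rx Pv _ _] := sdP v Tv; have [Pa _ _] := rx.
  have rs : redex P (flat s) (sd_rule (sd v)) (sd_subst (sd v)) (sd_pos (sd v)).
    by rewrite fs.
  have an : annotated (ct_term T v) (sd_pos (sd v)) -> annotated s (sd_pos (sd v)).
    by move=> /Pv ?; apply: contrapT => ?; apply: nstop.
  have [b [rb er eb]] := guarded_simulation adpP gs rs.
  have tp := redex_subterm rx; have sp := redex_subterm rs.
  exists b; split=> // x xr; rewrite eb; split; last exact: guarded_result.
  - by rewrite !flat_result fs.
  - move=> p; rewrite !annotated_result //.
    move=> [[h1 h2 h3]|[h1 h2]]; last by right; split=> //; exact: st.
    by left; split=> //; exact: st.
  (* New annotations arise only at an annotated redex, where [s] is annotated as well before a stop;
     so one [l] serves for the whole replay. *)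
  - move=> p; rewrite !annotated_result //.
    move=> [[h1 h2 h3]|[h1 h2]]; last by left; right; split=> //; exact: an.
    by have [h|h] := ts p h1; [left; left|right].
move=> w s' Tw gp' [Pw nan]; have iw := ct_P_inner ctT Pw.
have [rx Pan _ _] := sdP w iw.
(* Restoring the missing annotation takes one position off [l], so the induction hypothesis applies
   at the cut node. *)
have [pl [s'' gp'']] := guarded_part_add gp' rx (Pan.1 Pw) nan.
apply: IH gp'' => //; rewrite size_rem //.
by case: (l) pl ln.
Qed.

End Processor.

Theorem theorem17 (R : realType) (D C : signature) (V : Type)
    (P : set (adp R D C V)) (hP : adp_problem P) :
  iAST P <-> iAST (usable_rules_proc P).
Proof.
split; [exact: usable_rules_proc_complete|exact: usable_rules_proc_sound].
Qed.
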